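(* Let $X$ be a set. (1) A $[0,\infty]$-closure space structure $c$ on $X$ may be described, via $\delta(x,A)=(cA)(x)$, in terms of a point-set-distance function $\delta:X\times\mathsf PX\to[0,\infty]$ satisfying, for all $x\in X$, $B\subseteq X$, $\mathcal A\subseteq\mathsf PX$: (D1) $\delta(x,\{x\})=0$; (T') $\delta(x,\bigcup\mathcal A)\le \sup_{y\in B}\inf_{A\in\mathcal A}\big(\delta(x,B)+\delta(y,A)\big)$. The $[0,\infty]$-closure space $X$ is a $[0,\infty]$-approach space if and only if $\delta$ satisfies also, for all $x\in X$, $A,B\subseteq X$: (D2) $\delta(x,\emptyset)=\infty$; (D3) $\delta(x,A\cup B)=\min\{\delta(x,A),\delta(x,B)\}$; equivalently, if $X$ is an approach space in the ordinary sense, that is, $\delta$ satisfies (D1), (D2), (D3) and (D4) $\delta(x,A)\le\delta(x,A^{(\varepsilon)})+\varepsilon$ for all $x\in X$, $A\subseteq X$, $\varepsilon\in[0,\infty]$, where $A^{(\varepsilon)}:=\{y\in X\mid\delta(y,A)\le\varepsilon\}$. (2) A $[0,\infty]$-closure space structure on $X$ is equivalently described, via $c^\alpha A=\{x\in X\mid\delta(x,A)\le\alpha\}$ and $\delta(x,A)=\inf\{\alpha\mid x\in c^\alpha A\}$, by a closure tower $(c^\alpha:\mathsf PX\to\mathsf PX)_{\alpha\in[0,\infty]}$ satisfying, for all $A,B\subseteq X$ and $\alpha,\beta,\beta_i\in[0,\infty]$ ($i\in I$, $I$ any index set): (C0) if $B\subseteq A$, then $c^\alpha B\subseteq c^\alpha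 A$; (C1) if $\inf_{i\in I}\beta_i\le\alpha$, then $\bigcap_{i\in I}c^{\beta_i}A\subseteq c^\alpha A$; (C2) $A\subseteq c^0A$; (C3) $c^\alpha c^\beta A\subseteq c^{\alpha+\beta}A$. For $X$ to be an approach space, $(c^\alpha)_{\alpha\in[0,\infty]}$ must satisfy (C1)--(C3) and, for all $A,B\subseteq X$, $\alpha<\infty$: (C4) $c^\alpha(\emptyset)=\emptyset$; (C5) $c^\alpha(A\cup B)=c^\alpha A\cup c^\alpha B$ (that is, approach space structures on $X$ are equivalently described by families satisfying (C1)--(C5)). (3) A map $f:X\to Y$ of $[0,\infty]$-closure spaces $X,Y$, presented in terms of their respective closure towers $(c^\alpha),(d^\alpha)$, is contractive if and only if $f(c^\alpha A)\subseteq d^\alpha(f(A))$ for all $A\subseteq X$, $\alpha\in[0,\infty]$.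
   Context: $[0,\infty]$ is regarded as a quantale with lattice order the reverse $\ge$ of the natural order (so lattice joins are numerical infima, the lattice bottom is $\infty$, the lattice top is $0$), $\otimes=+$ (extended by $\alpha+\infty=\infty$) and neutral element $0$. In the displayed formulas, $\le$, $\inf$, $\sup$, $\min$ refer to the natural numerical order of $[0,\infty]$. $\mathsf PX$ is the power set of $X$; an empty intersection of subsets of $X$ is $X$. For a quantale $(\mathsf V,\otimes,\mathsf k)$ (a complete lattice with a monoid structure whose operation $\otimes$ preserves suprema in each variable), a $\mathsf V$-closure space $(X,c)$ is a set $X$ with a map $c:\mathsf PX\to\mathsf V^X$ such that, in the lattice order of $\mathsf V$, $\mathsf k\le c(\{x\})(x)$ for all $x\in X$ and $\big(\bigwedge_{y\in B}\bigvee_{A\in\mathcal A}(cA)(y)\big)\otimes (cB)(z)\le c(\bigcup\mathcal A)(z)$ for all $\mathcal A\subseteq\mathsf PX$, $B\subseteq X$, $z\in X$. It is a $\mathsf V$-approach space if in addition $(c\emptyset)(x)=\bot$ and $c(A\cup B)(x)=(cA)(x)\vee(cB)(x)$ for all $x\in X$, $A,B\subseteq X$. A map $f:(X,c)\to(Y,d)$ is contractive if $(cA)(x)\le(df(A))(f(x))$ (lattice order of $\mathsf V$) for all $A\subseteq X$, $x\in X$.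
   Formalization: Condition (T') is required only for nonempty B: for B empty the supremum in [0,∞] is 0, so the literal condition would force δ to vanish identically and the claimed equivalence would fail (e.g. for any approach space on a nonempty set). *)

(* Defs.v *)
From HB Require Import structures.
From mathcomp Require Import all_boot all_order all_algebra.
From mathcomp Require Import all_classical all_reals interval_inference ereal.

Set Implicit Arguments.
Unset Strict Implicit.
Unset Printing Implicit Defensive.

Import Order.TTheory GRing.Theory Num.Theory.
Local Open Scope classical_set_scope.
Local Open Scope order_scope.

HB.mixin Record POrder_isQuantale (d : Order.disp_t) V of Order.POrder d V := {
  qjoin : set V -> V;
  qmeet : set V -> V;
  qtens : V -> V -> V;
  qunit : V;
  qjoinP : forall S : set V, supremums S (qjoin S);
  qmeetP : forall S : set V, infimums S (qmeet S);
  qtensA : associative qtens;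
  qtens1l : left_id qunit qtens;
  qtens1r : right_id qunit qtens;
  qtens_joinr : forall (a : V) (S : set V),
    qtens a (qjoin S) = qjoin [set qtens a b | b in S];
  qtens_joinl : forall (S : set V) (b : V),
    qtens (qjoin S) b = qjoin [set qtens a b | a in S]
}.

#[short(type="quantaleType")]
HB.structure Definition Quantale (d : Order.disp_t) :=
  { V of POrder_isQuantale d V & Order.POrder d V }.

Definition qbot (d : Order.disp_t) (V : quantaleType d) : V := qjoin set0.

Section VClosureSpaces.
Context (d : Order.disp_t) (V : quantaleType d).

Definition closure_space (X : Type) (c : set X -> X -> V) : Prop :=
  (forall x : X, (qunit : V) <= c [set x] x) /\
  (forall (AA : set (set X)) (B : set X) (z : X),
     qtens (qmeet [set qjoin [set c A y | A in AA] | y in B]) (c B z)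
       <= c (\bigcup_(A in AA) A) z).

Definition approach_space (X : Type) (c : set X -> X -> V) : Prop :=
  [/\ closure_space c,
      forall x : X, c set0 x = qbot V &
      forall (A B : set X) (x : X),
        c (A `|` B) x = qjoin [set c A x; c B x]].

Definition contractive (X Y : Type) (c : set X -> X -> V)
    (e : set Y -> Y -> V) (f : X -> Y) : Prop :=
  forall (A : set X) (x : X), c A x <= e (f @` A) (f x).

End VClosureSpaces.

Section ExtendedHalfLine.
Context (R : realType).
Local Open Scope ring_scope.
Local Open Scope ereal_scope.

Definition enn0 : {nonneg \bar R} := 0%:E%:nng.

Definition enn_add (a b : {nonneg \bar R}) : {nonneg \bar R} :=
  (adde a%:num b%:num)%:nng.

Lemma enn_addE (a b : {nonneg \bar R}) :
  (enn_add a b)%:num = a%:num + b%:num.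
Proof. by []. Qed.

Definition enn_inf (S : set {nonneg \bar R}) : {nonneg \bar R} :=
  (ereal_inf [set a%:num | a in S])%:nng.

(* The maximum with 0 only matters for S empty, where ereal_sup is -oo while
   the supremum of the empty subset of [0, +oo] is 0. *)
Definition enn_sup (S : set {nonneg \bar R}) : {nonneg \bar R} :=
  (maxe 0%:E (ereal_sup [set a%:num | a in S]))%:nng.

Lemma enn_infP (S : set {nonneg \bar R}) : infimums S (enn_inf S).
Proof.
split=> [a Sa | b Sb].
  by apply: ereal_inf_lbound; exists a.
by apply: le_ereal_inf_tmp => _ [a Sa <-]; exact: Sb.
Qed.

Lemma enn_supP (S : set {nonneg \bar R}) : supremums S (enn_sup S).
Proof.
split=> [a Sa | b Sb].
  change (a%:num <= maxe 0%:E (ereal_sup [set a%:num | a in S])).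
  by rewrite le_max; apply/orP; right; apply: ereal_sup_ubound; exists a.
change (maxe 0%:E (ereal_sup [set a%:num | a in S]) <= b%:num).
rewrite ge_max ge0e /=.
by apply: ge_ereal_sup => _ [a Sa <-]; exact: Sb.
Qed.

Lemma enn_addC : commutative enn_add.
Proof. by move=> a b; apply: val_inj => /=; exact: addeC. Qed.

Lemma enn_addA : associative enn_add.
Proof. by move=> a b c; apply: val_inj => /=; exact: addeA. Qed.

Lemma enn_add0l : left_id enn0 enn_add.
Proof. by move=> a; apply: val_inj => /=; exact: add0e. Qed.

Lemma enn_add0r : right_id enn0 enn_add.
Proof. by move=> a; rewrite enn_addC enn_add0l. Qed.

Lemma enn_add_infr (a : {nonneg \bar R}) (S : set {nonneg \bar R}) :
  enn_add a (enn_inf S) = enn_inf [set enn_add a b | b in S].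
Proof.
apply: val_inj.
change (a%:num + ereal_inf [set b%:num | b in S] =
        ereal_inf [set b%:num | b in [set enn_add a b | b in S]]).
apply/eqP; rewrite eq_le; apply/andP; split.
  apply: le_ereal_inf_tmp => _ [_ [b Sb <-] <-]; rewrite enn_addE.
  by rewrite leeD2l //; apply: ereal_inf_lbound; exists b.
have : 0 <= a%:num by rewrite ge0e.
case Ea : (a%:num) => [r||] // _.
  rewrite -leeBlDl //; apply: le_ereal_inf_tmp => _ [b Sb <-].
  rewrite leeBlDl // -Ea.
  by apply: ereal_inf_lbound; exists (enn_add a b) => //; exists b.
rewrite addye ?leey //.
by rewrite gt_eqF // (@lt_le_trans _ _ 0) // ?ltNy0.
Qed.

Lemma enn_add_infl (S : set {nonneg \bar R}) (b : {nonneg \bar R}) :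
  enn_add (enn_inf S) b = enn_inf [set enn_add a b | a in S].
Proof.
rewrite enn_addC enn_add_infr; congr enn_inf.
by apply/seteqP; split=> _ [a Sa <-]; exists a; rewrite // enn_addC.
Qed.

End ExtendedHalfLine.

(* [0, +oo] with the reverse of the numerical order, as a quantale. *)
Definition ennq (R : realType) : Type := ({nonneg \bar R}^d)%type.

HB.instance Definition _ (R : realType) := Order.POrder.on (ennq R).

HB.instance Definition _ (R : realType) :=
  @POrder_isQuantale.Build _ (ennq R)
    (@enn_inf R) (@enn_sup R) (@enn_add R) (@enn0 R)
    (@enn_infP R) (@enn_supP R) (@enn_addA R) (@enn_add0l R) (@enn_add0r R)
    (@enn_add_infr R) (@enn_add_infl R).

Section DistancesAndTowers.
Context (R : realType) (X : Type).
Local Open Scope ring_scope.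
Local Open Scope ereal_scope.

Definition distance_of_closure (c : set X -> X -> ennq R) :
  X -> set X -> {nonneg \bar R} := fun x A => c A x.

Definition closure_of_distance (delta : X -> set X -> {nonneg \bar R}) :
  set X -> X -> ennq R := fun A x => delta x A.

Definition axiom_D1 (delta : X -> set X -> {nonneg \bar R}) : Prop :=
  forall x, (delta x [set x])%:num = 0.

(* B is required to be nonempty. For B empty the supremum in [0, +oo] would
   be 0, and the axiom would force delta x A = 0 for all x and A; what the
   V-closure axiom says for B empty is delta x (\bigcup_(A in AA) A) <=
   delta x set0, which follows from D1 and the instance of the axiom below
   for [set x] and set0 |` AA. *)
Definition axiom_T' (delta : X -> set X -> {nonneg \bar R}) : Prop :=
  forall (x : X) (B : set X) (AA : set (set X)), B !=set0 ->
    (delta x (\bigcup_(A in AA) A))%:num <=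
    ereal_sup [set ereal_inf [set (delta x B)%:num + (delta y A)%:num
                             | A in AA] | y in B].

Definition axiom_D2 (delta : X -> set X -> {nonneg \bar R}) : Prop :=
  forall x, (delta x set0)%:num = +oo.

Definition axiom_D3 (delta : X -> set X -> {nonneg \bar R}) : Prop :=
  forall x A B,
    (delta x (A `|` B))%:num = mine (delta x A)%:num (delta x B)%:num.

Definition axiom_D4 (delta : X -> set X -> {nonneg \bar R}) : Prop :=
  forall x A (eps : {nonneg \bar R}),
    (delta x A)%:num <=
    (delta x [set y | (delta y A)%:num <= eps%:num])%:num + eps%:num.

Definition tower_of_distance (delta : X -> set X -> {nonneg \bar R}) :
  {nonneg \bar R} -> set X -> set X :=
  fun alpha A => [set x | (delta x A)%:num <= alpha%:num].

Definition distance_of_tower (t : {nonneg \bar R} -> set X -> set X) :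
  X -> set X -> {nonneg \bar R} :=
  fun x A => enn_inf [set alpha | t alpha A x].

Definition axiom_C0 (t : {nonneg \bar R} -> set X -> set X) : Prop :=
  forall alpha A B, B `<=` A -> t alpha B `<=` t alpha A.

Definition axiom_C1 (t : {nonneg \bar R} -> set X -> set X) : Prop :=
  forall (A : set X) (alpha : {nonneg \bar R})
         (I : Type) (beta : I -> {nonneg \bar R}),
    ereal_inf [set (beta i)%:num | i in [set: I]] <= alpha%:num ->
    \bigcap_(i in [set: I]) t (beta i) A `<=` t alpha A.

Definition axiom_C2 (t : {nonneg \bar R} -> set X -> set X) : Prop :=
  forall A, A `<=` t (@enn0 R) A.

Definition axiom_C3 (t : {nonneg \bar R} -> set X -> set X) : Prop :=
  forall alpha beta A, t alpha (t beta A) `<=` t (enn_add alpha beta) A.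

Definition axiom_C4 (t : {nonneg \bar R} -> set X -> set X) : Prop :=
  forall alpha, alpha%:num < +oo -> t alpha set0 = set0.

Definition axiom_C5 (t : {nonneg \bar R} -> set X -> set X) : Prop :=
  forall alpha A B, alpha%:num < +oo ->
    t alpha (A `|` B) = t alpha A `|` t alpha B.

End DistancesAndTowers.

(* F and G restrict to mutually inverse bijections between the S-elements
   satisfying P and the T-elements satisfying Q. *)
Definition equivalently_described (S T : Type) (P : S -> Prop) (Q : T -> Prop)
    (F : S -> T) (G : T -> S) : Prop :=
  [/\ forall s, P s -> Q (F s),
      forall t, Q t -> P (G t),
      forall s, P s -> G (F s) = s &
      forall t, Q t -> F (G t) = t].

(* Main.v *)
(** Everything passes through one intermediate description: a closure space
    structure is a distance that satisfies D1 and D4 and is antitone in the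
    set.  Given that, a family [AA] and a set [B] with
    [s = sup_(y in B) inf_(A in AA) delta y A] satisfy
    [B `<=` (\bigcup AA)^(s)] by antitonicity, and D4 at level [s] is the
    closure axiom.  Conversely D4 is the closure axiom for the family
    [[set A]].  D4 is also C3 read off the sublevel sets of [delta], while C1
    says that [alpha] lies above [distance_of_tower t x A] exactly when [x]
    lies in [t alpha A].  D3, or C5, forces antitonicity, so that C0 is
    redundant for approach spaces. *)
Require Import Defs.
From HB Require Import structures.
From mathcomp Require Import all_boot all_order all_algebra.
From mathcomp Require Import all_classical all_reals interval_inference ereal.

Set Implicit Arguments.
Unset Strict Implicit.
Unset Printing Implicit Defensive.

Import Order.TTheory GRing.Theory Num.Theory.
Local Open Scope classical_set_scope.

Section Distances.
Context (R : realType) (X : Type).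
Local Open Scope ring_scope.
Local Open Scope ereal_scope.
Implicit Types (delta : X -> set X -> {nonneg \bar R}).
Implicit Types (t : {nonneg \bar R} -> set X -> set X).
Implicit Types (c : set X -> X -> ennq R).

(** Antitone in the numerical order, which is monotone in the reversed order of [ennq R]. *)
Definition axiom_mono delta : Prop :=
  forall x A B, B `<=` A -> (delta x A)%:num <= (delta x B)%:num.

(** * Infima and suprema in the extended half-line *)

Lemma nnum_ge0 (a : {nonneg \bar R}) : 0 <= a%:num.
Proof. by rewrite ge0e. Qed.

Lemma nnum_inj (a b : {nonneg \bar R}) : a%:num = b%:num -> a = b.
Proof. exact: val_inj. Qed.

Lemma enn_infE (S : set {nonneg \bar R}) :
  (enn_inf S)%:num = ereal_inf [set a%:num | a in S].
Proof. by []. Qed.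

Lemma le_enn_sup (S : set {nonneg \bar R})
    (a : {nonneg \bar R}) :
  S a -> a%:num <= (enn_sup S)%:num.
Proof. exact: (enn_supP S).1. Qed.

Lemma ge_enn_sup (S : set {nonneg \bar R})
    (b : {nonneg \bar R}) :
  (forall a, S a -> a%:num <= b%:num) -> (enn_sup S)%:num <= b%:num.
Proof. by move=> Sb; apply: (enn_supP S).2. Qed.

Lemma ge_enn_inf (S : set {nonneg \bar R})
    (a : {nonneg \bar R}) :
  S a -> (enn_inf S)%:num <= a%:num.
Proof. exact: (enn_infP S).1. Qed.

Lemma le_enn_inf (S : set {nonneg \bar R})
    (b : {nonneg \bar R}) :
  (forall a, S a -> b%:num <= a%:num) -> b%:num <= (enn_inf S)%:num.
Proof. by move=> Sb; apply: (enn_infP S).2. Qed.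

Lemma enn_inf1 (a : {nonneg \bar R}) : enn_inf [set a] = a.
Proof. by apply: nnum_inj; rewrite enn_infE image_set1 ereal_inf1. Qed.

Lemma enn_inf0 : (enn_inf (@set0 {nonneg \bar R}))%:num = +oo.
Proof. by rewrite enn_infE image_set0 ereal_inf0. Qed.

Lemma enn_inf2 (a b : {nonneg \bar R}) :
  (enn_inf [set a; b])%:num = mine a%:num b%:num.
Proof.
apply/eqP; rewrite eq_le; apply/andP; split.
  by rewrite le_min !ge_enn_inf //; [right|left].
have [ab|/ltW ba] := leP a%:num b%:num.
  by apply: le_enn_inf => _ [->|->].
by apply: le_enn_inf => _ [->|->].
Qed.

(** * Closure axioms in terms of distances *)

Lemma bigcup_set2 (A B : set X) : \bigcup_(C in [set A; B]) C = A `|` B.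
Proof. by rewrite bigcup_setU1 bigcup_set1. Qed.

Lemma mem_distance0 delta : axiom_D1 delta -> axiom_mono delta ->
  forall (A : set X) x, A x -> (delta x A)%:num = 0.
Proof.
move=> D1 Dm A x Ax; apply/eqP; rewrite eq_le nnum_ge0 andbT.
by rewrite -(D1 x); apply: Dm => _ ->.
Qed.

Lemma axiom_D3_mono delta : axiom_D3 delta -> axiom_mono delta.
Proof. by move=> D3 x A B /setUidPr <-; rewrite D3 ge_min lexx. Qed.

Lemma closure_space_distanceE c : closure_space c <->
  (forall x, (c [set x] x)%:num <= 0) /\
  (forall (AA : set (set X)) (B : set X) z,
     (c (\bigcup_(A in AA) A) z)%:num <=
     (enn_sup [set enn_inf [set c A y | A in AA] | y in B])%:num
       + (c B z)%:num).
Proof. by []. Qed.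

Lemma closure_spaceP c : closure_space c <->
  [/\ axiom_D1 (distance_of_closure c), axiom_mono (distance_of_closure c)
    & axiom_D4 (distance_of_closure c)].
Proof.
rewrite closure_space_distanceE; split=> [[c1 cT]|[D1 Dm D4]]; last first.
  split=> [x|AA B z]; first by rewrite [X in X <= _](D1 x).
  set s := enn_sup _; rewrite addeC.
  apply: le_trans (D4 z _ s) _; apply: leeD => //; apply: (Dm) => y By.
  apply: (@le_trans _ _ (enn_inf [set c A y | A in AA])%:num).
    apply: le_enn_inf => _ [A AA_A <-]; apply: Dm; exact: bigcup_sup.
  by apply: le_enn_sup; exists y.
have c0 A y : A y -> (c A y)%:num <= 0.
  (* The union of this family is [A], since [y] lies in [A], and its member [[set y]] brings the
     infimum at [y] down to 0. *)
  move=> Ay; have := cT [set [set y]; A] [set y] y.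
  rewrite bigcup_set2 (setUidPr _ _).2 => [|_ ->//].
  move=> /le_trans; apply; rewrite -[leRHS]adde0 leeD //.
  apply: (@ge_enn_sup _ (enn0 R)) => _ [_ -> <-].
  apply: (le_trans _ (c1 y)); apply: ge_enn_inf.
  by exists [set y] => //; left.
(* The closure axiom for the family [[set A]]. With [s = 0] and [B] inside [A] it gives
   antitonicity; with [B] the set of points at distance at most [e] from [A] it gives D4. *)
have cT1 A B z (s : {nonneg \bar R}) :
    (forall y, B y -> (c A y)%:num <= s%:num) ->
    (c A z)%:num <= (c B z)%:num + s%:num.
  move=> Bs; have := cT [set A] B z; rewrite bigcup_set1 addeC.
  move=> /le_trans; apply; apply: leeD => //.
  apply: ge_enn_sup => _ [y By <-].
  by rewrite image_set1 enn_inf1; exact: Bs.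
split=> [x|x A B BA|x A e].
- by apply/eqP; rewrite eq_le nnum_ge0 andbT; exact: c1.
- rewrite -[leRHS]adde0; apply: (cT1 _ _ _ (enn0 R)) => y By.
  exact/c0/BA.
- exact: cT1.
Qed.

(** T' differs from the closure axiom in that [delta x B] stands under the supremum and infimum and
    [B] is nonempty. The proof has to pull this term out in one direction and to recover empty [B]
    in the other. *)
Lemma axiom_T'P delta : axiom_D1 delta /\ axiom_T' delta <->
  [/\ axiom_D1 delta, axiom_mono delta & axiom_D4 delta].
Proof.
split=> [[D1 DT]|[D1 Dm D4]]; last first.
  split=> // x B AA [y0 By0]; set u := ereal_sup _.
  have leu y : B y ->
      (delta x B)%:num + (delta y (\bigcup_(A in AA) A))%:num <= u.
    move=> By; apply: le_trans; last first.
      by apply: ereal_sup_ubound; exists y.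
    apply: le_ereal_inf_tmp => _ [A AA_A <-]; apply: leeD => //; apply: Dm.
    exact: bigcup_sup.
  (* If [delta x B] is finite, it can be subtracted from [u], and D4 applies at level
     [u - delta x B]. If it is infinite, then so is [u], because [B] has the point [y0]. *)
  have := nnum_ge0 (delta x B); case Er : (delta x B)%:num => [r||] // r0.
    have s0 : 0 <= u - r%:E.
      rewrite leeBrDr // add0e -Er; apply: le_trans (leu _ By0).
      by rewrite leeDl ?nnum_ge0.
    have [s Es] : exists s : {nonneg \bar R}, s%:num = u - r%:E.
      (* The absolute value only serves to build an element of the nonnegative type. *)
      by exists (`|u - r%:E|)%:nng; exact: gee0_abs.
    apply: le_trans (D4 x _ s) _.
    apply: (@le_trans _ _ (r%:E + s%:num)); last by rewrite Es addeC subeK.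
    rewrite -Er; apply: leeD => //; apply: (Dm) => y By.
    by rewrite /= Es leeBrDr // -Er addeC; exact: leu.
  apply: (le_trans _ (leu _ By0)); rewrite Er addye ?leey //.
  by rewrite gt_eqF // (lt_le_trans ltNy0) ?nnum_ge0.
(* T' in usable form: each infimum is bounded by one chosen member of the family. *)
have Tle x B (AA : set (set X)) u : B !=set0 ->
    (forall y, B y ->
       exists2 A, AA A & (delta x B)%:num + (delta y A)%:num <= u) ->
    (delta x (\bigcup_(A in AA) A))%:num <= u.
  move=> B0 Bu; apply: le_trans (DT x B AA B0) _.
  apply: ge_ereal_sup => _ [y By <-]; have [A AA_A le_u] := Bu y By.
  by apply: le_trans le_u; apply: ereal_inf_lbound; exists A.
have D0 x A : A x -> (delta x A)%:num <= 0.
  move=> Ax; have -> : A = \bigcup_(A in [set [set x]; A]) A.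
    by rewrite bigcup_set2 (setUidPr _ _).2 // => _ ->.
  apply: (Tle _ [set x]) => [|_ ->]; first by exists x.
  by exists [set x]; [left|rewrite D1 adde0].
(* This settles [B = set0] in [Dle]: the family consisting of [set0] and [A] still has union [A],
   and T' is applied to it with [[set x]]. *)
have Dm0 x A : (delta x A)%:num <= (delta x set0)%:num.
  rewrite -[A]set0U -bigcup_set2.
  apply: (Tle _ [set x]) => [|_ ->]; first by exists x.
  by exists set0; [left|rewrite D1 add0e].
have Dle x A B (s : {nonneg \bar R}) :
    (forall y, B y -> (delta y A)%:num <= s%:num) ->
    (delta x A)%:num <= (delta x B)%:num + s%:num.
  have [->|/set0P B0 Bs] := eqVneq B set0.
    by move=> _; apply: le_trans (Dm0 x A) _; rewrite leeDl ?nnum_ge0.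
  have := Tle x B [set A]; rewrite bigcup_set1; apply=> // y By.
  by exists A => //; apply: leeD => //; exact: Bs.
split=> // [x A B BA|x A e]; last exact: Dle.
by rewrite -[leRHS]adde0; apply: (Dle _ _ _ (enn0 R)) => y /BA; exact: D0.
Qed.

(** The lattice bottom is the infimum of the empty set, [+oo], and binary joins are numerical
    minima. *)
Lemma approach_spaceE c : approach_space c <->
  [/\ closure_space c, axiom_D2 (distance_of_closure c)
    & axiom_D3 (distance_of_closure c)].
Proof.
split=> -[cs c0 cU]; (split=> //; [move=> x|move=> ? ? ?]).
- by rewrite /distance_of_closure c0; exact: enn_inf0.
- by rewrite /distance_of_closure cU; exact: enn_inf2.
- by apply: nnum_inj; rewrite [LHS]c0; exact/esym/enn_inf0.
- by apply: nnum_inj; rewrite [LHS]cU; exact/esym/enn_inf2.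
Qed.

Lemma approach_spaceP c : approach_space c <->
  [/\ axiom_D1 (distance_of_closure c), axiom_D2 (distance_of_closure c),
      axiom_D3 (distance_of_closure c) & axiom_D4 (distance_of_closure c)].
Proof.
rewrite approach_spaceE; split=> [[/closure_spaceP[? _ ?] ? ?]|[? ? D3 ?]] //.
by split=> //; apply/closure_spaceP; split=> //; exact: axiom_D3_mono.
Qed.

(** * Distances and closure towers *)

Lemma tower_of_distanceK delta :
  distance_of_tower (tower_of_distance delta) = delta.
Proof.
apply/funext => x; apply/funext => A; apply: nnum_inj; apply/eqP.
(* The infimum is attained: [delta x A] is itself the least level containing [x]. *)
by rewrite eq_le ge_enn_inf /tower_of_distance //=; exact: le_enn_inf.
Qed.

Lemma distance_of_tower_le t : axiom_C1 t ->
  forall x A (alpha : {nonneg \bar R}),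
  (distance_of_tower t x A)%:num <= alpha%:num <-> t alpha A x.
Proof.
move=> C1 x A alpha; split=> [le_alpha|]; last exact: ge_enn_inf.
(* The index type collects all levels at which [x] belongs to the tower, so the infimum in C1 is the
   distance. *)
apply: (C1 A alpha {b | t b A x} (fun b => sval b)).
  apply: le_trans le_alpha; apply: le_ereal_inf_tmp => _ [b tb <-].
  by apply: ereal_inf_lbound; exists (exist _ b tb).
by move=> [b tb] _.
Qed.

Lemma distance_of_towerK t :
  axiom_C1 t -> tower_of_distance (distance_of_tower t) = t.
Proof.
move=> C1; apply/funext => alpha; apply/funext => A.
by apply/seteqP; split=> x /distance_of_tower_le; apply.
Qed.

Lemma tower_of_distance_C1 delta : axiom_C1 (tower_of_distance delta).
Proof.
move=> A alpha I beta le_alpha x tx; apply: le_trans le_alpha.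
by apply: le_ereal_inf_tmp => _ [i _ <-]; exact: tx.
Qed.

Lemma tower_of_distanceP delta :
  [/\ axiom_D1 delta, axiom_mono delta & axiom_D4 delta] <->
  [/\ axiom_C0 (tower_of_distance delta), axiom_C2 (tower_of_distance delta)
    & axiom_C3 (tower_of_distance delta)].
Proof.
split=> [[D1 Dm D4]|[C0 C2 C3]]; split.
- by move=> alpha A B BA x; apply: le_trans; exact: Dm.
- by move=> A x Ax; rewrite /tower_of_distance /= mem_distance0.
- move=> alpha beta A x le_alpha; apply: le_trans (D4 x A beta) _.
  exact: leeD.
- move=> x; apply/eqP; rewrite eq_le nnum_ge0 andbT.
  exact: (C2 [set x] x).
(* The level is [delta x B], where [x] enters the tower of [B]; D4 below likewise takes the distance
   from [x] to the enlarged set. *)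
- by move=> x A B BA; apply: (C0 _ _ _ BA); exact: lexx.
- by move=> x A e; apply: (C3 _ e A x); exact: lexx.
Qed.

Lemma tower_of_distance_C4 delta :
  axiom_D2 delta <-> axiom_C4 (tower_of_distance delta).
Proof.
split=> [D2 alpha ltoo|C4 x].
  apply/seteqP; split=> // x; rewrite /tower_of_distance /= D2.
  by rewrite leNgt ltoo.
apply/eqP; rewrite eq_le leey /= leNgt; apply/negP => /C4.
by move=> /seteqP[/(_ x) + _]; apply; exact: lexx.
Qed.

(** For D3, antitonicity bounds the distance to a union by the minimum. The converse bound is C5 at
    the level equal to that distance, and is trivial when the distance is infinite. *)
Lemma tower_of_distance_C5 delta :
  axiom_D3 delta <->
  axiom_mono delta /\ axiom_C5 (tower_of_distance delta).
Proof.
split=> [D3|[Dm C5] x A B].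
  split; first exact: axiom_D3_mono.
  move=> alpha A B _; apply/seteqP; rewrite /tower_of_distance.
  by split=> x /=; rewrite D3 ge_min => /orP.
apply/eqP; rewrite eq_le le_min (Dm _ _ _ (@subsetUl _ A B)).
rewrite (Dm _ _ _ (@subsetUr _ A B)) /=.
have [ltoo|] := ltP (delta x (A `|` B))%:num +oo; last first.
  by rewrite leye_eq => /eqP ->; exact: leey.
have /seteqP[/(_ x) + _] := C5 _ A B ltoo.
by rewrite ge_min => /(_ (lexx _)) [->//|->]; rewrite orbT.
Qed.

Lemma axiom_C5_C0 t : axiom_C1 t -> axiom_C5 t -> axiom_C0 t.
Proof.
move=> C1 C5 alpha A B BA x tx.
have [ltoo|] := ltP alpha%:num +oo.
  by rewrite -((setUidPr _ _).2 BA) C5 //; left.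
(* [C1] for the empty family makes the tower at level [+oo] the whole space *)
rewrite leye_eq => /eqP alphaoo; apply: (C1 A alpha Empty_set (fun=> alpha)).
  by rewrite alphaoo leey.
by case.
Qed.

End Distances.

Theorem corollary2p13 (R : realType) (X : Type) :
  (* (1) *)
  [/\ equivalently_described
        (fun c : set X -> X -> ennq R => closure_space c)
        (fun delta => axiom_D1 delta /\ axiom_T' delta)
        (@distance_of_closure R X) (@closure_of_distance R X),
      (forall c : set X -> X -> ennq R, closure_space c ->
         (approach_space c <->
          axiom_D2 (distance_of_closure c) /\
          axiom_D3 (distance_of_closure c))) &
      (forall c : set X -> X -> ennq R,
         approach_space c <->
         [/\ axiom_D1 (distance_of_closure c),
             axiom_D2 (distance_of_closure c),
             axiom_D3 (distance_of_closure c) &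
             axiom_D4 (distance_of_closure c)])] /\
  (* (2) *)
  (equivalently_described
     (fun c : set X -> X -> ennq R => closure_space c)
     (fun t => [/\ axiom_C0 t, axiom_C1 t, axiom_C2 t & axiom_C3 t])
     (fun c => tower_of_distance (distance_of_closure c))
     (fun t => closure_of_distance (distance_of_tower t)) /\
   equivalently_described
     (fun c : set X -> X -> ennq R => approach_space c)
     (fun t => [/\ axiom_C1 t, axiom_C2 t, axiom_C3 t, axiom_C4 t
                 & axiom_C5 t])
     (fun c => tower_of_distance (distance_of_closure c))
     (fun t => closure_of_distance (distance_of_tower t))) /\
  (* (3) *)
  (forall (Y : Type) (c : set X -> X -> ennq R) (e : set Y -> Y -> ennq R)
          (f : X -> Y),
     closure_space c -> closure_space e ->
     (contractive c e f <->
      forall (A : set X) (alpha : {nonneg \bar R}),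
        f @` tower_of_distance (distance_of_closure c) alpha A `<=`
        tower_of_distance (distance_of_closure e) alpha (f @` A))).
Proof.
split; [split|split; [split|]].
(* Both round trips hold by conversion, as the two maps only swap arguments. *)
- split=> // [c /closure_spaceP|delta]; first by move=> /axiom_T'P.
  by move=> /axiom_T'P ?; exact/closure_spaceP.
- by move=> c cs; rewrite approach_spaceE; split=> [[]|[]].
- exact: approach_spaceP.
- split=> [c /closure_spaceP/tower_of_distanceP[C0 C2 C3]|t [C0 C1 C2 C3]
         |c _|t [_ C1 _ _]].
  + by split=> //; exact: tower_of_distance_C1.
  + apply/closure_spaceP/tower_of_distanceP.
    by rewrite [tower_of_distance _]distance_of_towerK.
  + by rewrite tower_of_distanceK.
  + by rewrite [LHS]distance_of_towerK.
- split=> [c /approach_spaceE[]|t [C1 C2 C3 C4 C5]|c _|t [C1 _ _ _ _]].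
  + move=> /closure_spaceP/tower_of_distanceP[_ C2 C3].
    move=> /tower_of_distance_C4 C4 /tower_of_distance_C5[_ C5].
    by split=> //; exact: tower_of_distance_C1.
  + have tK := distance_of_towerK C1.
    have D : [/\ axiom_D1 (distance_of_tower t),
        axiom_mono (distance_of_tower t) & axiom_D4 (distance_of_tower t)].
      by apply/tower_of_distanceP; rewrite tK; split=> //; exact: axiom_C5_C0.
    apply/approach_spaceE; split; first exact/closure_spaceP.
      by apply/tower_of_distance_C4; rewrite [tower_of_distance _]tK.
    case: D => _ Dm _; apply/tower_of_distance_C5; split=> //.
    by rewrite [tower_of_distance _]tK.
  + by rewrite tower_of_distanceK.
  + by rewrite [LHS]distance_of_towerK.
- move=> Y c e f _ _; split=> [cf A alpha _ [x le_alpha <-]|cf A x].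
    by apply: le_trans le_alpha; exact: (cf A x).
  (* Contractivity at [x] is the tower inclusion at the level [c A x]. *)
  by apply: (cf A (c A x)); exists x => //; exact: lexx.
Qed.
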